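(* Let $\alpha\in(0,1)$, and let $1<\gamma<1/(1-\alpha)$ be such that $\gamma\rho_\mu<1$. For any $\epsilon>0$, the $n_{\epsilon/2,k}$-stage optimal policy $\phi_{\alpha,n_{\epsilon/2,k}}\in\Phi$ of Value Iteration is $\epsilon$-optimal for the initial queue length distribution $\pi_\mu$, i.e. $s_\alpha^{\phi_{\alpha,n_{\epsilon/2,k}}}(\pi_\mu)\ge s_\alpha(\pi_\mu)-\epsilon$. Here $$k=\Big\lceil\log_{\gamma\rho_\mu}\Big(\frac{\epsilon(1-\gamma\rho_\mu)(1-(1-\alpha)\gamma)}{2u_M(1-\rho_\mu)}\Big)\Big\rceil$$ and, for $\epsilon'>0$ and $i\in\mathbb{N}_0$, $n_{\epsilon',i}=\Big\lceil\log_{(1-\alpha)\gamma}\Big(\frac{\epsilon'(1-(1-\alpha)\gamma)}{2u_M\gamma^i}\Big)\Big\rceil$.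
   Context: Model. Real parameters $\lambda,\beta>0$ and $0<\mu_1<\mu_2$ satisfy $\lambda+\mu_1+\mu_2+\beta=1$; service cost rates $0=c_{\mu_1}<c_{\mu_2}$; a fixed rate $\mu\in\{\mu_1,\mu_2\}$ with $\mu>\lambda$. The holding cost $h:\mathbb{N}_0\to\mathbb{R}$ satisfies $h(0)=0$, is non-negative, non-decreasing, convex, unbounded, and $\sum_{i\ge 0}h(i)x^i<\infty$ for all $0<x<1$. $\rho_\mu=\lambda/\mu$ and $\pi_\mu(i)=(1-\rho_\mu)\rho_\mu^i$, $i\in\mathbb{N}_0$. State space $S=\mathbb{N}_0\times\{0,1\}$. $\Phi$ is the set of stationary deterministic policies $\phi$, with $\phi(i,1)\in\{\mu_1,\mu_2\}$ and $\phi(i,0)=\mu$. Under $\phi$, the discrete-time Markov chain $(Y_n)$ on $S$ has the following transitions. From $(i,1)$ with $a=\phi(i,1)$: to $(i+1,1)$ w.p. $\lambda$, to $(i,0)$ w.p. $\beta$, to $(i-1,1)$ w.p. $a\mathbf 1_{\{i>0\}}$, to $(i,1)$ otherwise. From $(i,0)$: to $(i+1,0)$ w.p. $\lambda$, to $(i-1,0)$ w.p. $\mu\mathbf 1_{\{i>0\}}$, to $(i,0)$ otherwise. One-step costs: $c^\phi(i,1)=c_{\phi(i,1)}+h(i)$, $c^\phi(i,0)=c_\mu+h(i)$. $V^\phi_\alpha(x)=\mathbb{E}^\phi_x\big[\sum_{n\ge0}(1-\alpha)^nc^\phi(Y_n)\big]$. The expected discounted saved cost from initial queue length distribution $\pi_\mu$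 is $s_\alpha(\pi_\mu)=\sup_{\phi\in\Phi}s^\phi_\alpha(\pi_\mu)$ with $s^\phi_\alpha(\pi_\mu)=\sum_{i\ge0}\pi_\mu(i)\big(V_\alpha^\phi(i,0)-V_\alpha^\phi(i,1)\big)$. The constant $u_M>0$ satisfies $u_M\ge\sup_{\phi\in\Phi}\sup_{(i,q)\in S}|c^\phi(i,q)|/\gamma^i$. Write $i^+=\max\{i,0\}$. Value Iteration. $V_{\alpha,0}\equiv0$ and, for $n\ge 0$, $$V_{\alpha,n+1}(i,1)=h(i)+(1-\alpha)\big(\mu_1V_{\alpha,n}(i,1)+\mu_1V_{\alpha,n}((i-1)^+,1)+\lambda V_{\alpha,n}(i+1,1)+\beta V_{\alpha,n}(i,0)\big)+\min_{a\in\{\mu_1,\mu_2\}}\big\{c_a+(1-\alpha)\big((a-\mu_1)V_{\alpha,n}((i-1)^+,1)+(\mu_2-a)V_{\alpha,n}(i,1)\big)\big\},$$ $$V_{\alpha,n+1}(i,0)=c_\mu+h(i)+(1-\alpha)\big(\mu V_{\alpha,n}((i-1)^+,0)+(1-\mu-\lambda)V_{\alpha,n}(i,0)+\lambda V_{\alpha,n}(i+1,0)\big).$$ The $n$-stage optimal policy $\phi_{\alpha,n}$ ($n\ge1$) picks in each $(i,1)$ the minimising action $a$ in the formula defining $V_{\alpha,n}(i,1)$ from $V_{\alpha,n-1}$ (ties resolved in favour of $\mu_1$). If the formula for $k$ gives a negative value it is read as $0$; if the formula for $n_{\epsilon',i}$ gives a non-positive value it is read as $1$. *)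

(* Defs.v *)
From HB Require Import structures.
From mathcomp Require Import all_boot all_order all_algebra.
From mathcomp Require Import all_classical all_reals all_analysis.

Set Implicit Arguments.
Unset Strict Implicit.
Unset Printing Implicit Defensive.

Import Order.TTheory GRing.Theory Num.Theory.
Import numFieldNormedType.Exports.

Local Open Scope classical_set_scope.
Local Open Scope ring_scope.

(* (i, true) is the state (i, 1), in which the service rate is controlled;
   (i, false) is the state (i, 0), in which the rate is fixed. *)
Definition state : Type := (nat * bool)%type.

Record model (R : realType) : Type := Model {
  lambda : R;
  beta : R;
  mu1 : R;
  mu2 : R;
  mu : R;
  (* service cost rate c_a of the service rate a; only its values at mu1 and
     mu2 matter *)
  cost : R -> R;
  h : nat -> R;
  lambda_gt0 : 0 < lambda;
  beta_gt0 : 0 < beta;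
  mu1_gt0 : 0 < mu1;
  mu1_lt_mu2 : mu1 < mu2;
  rates_sum1 : lambda + mu1 + mu2 + beta = 1;
  cost_mu1 : cost mu1 = 0;
  cost_mu2 : 0 < cost mu2;
  mu_in : mu = mu1 \/ mu = mu2;
  lambda_lt_mu : lambda < mu;
  h0 : h 0%N = 0;
  h_ge0 : forall i, 0 <= h i;
  h_nondecreasing : forall i j, (i <= j)%N -> h i <= h j;
  h_convex : forall i, h i.+1 - h i <= h i.+2 - h i.+1;
  h_unbounded : forall A : R, exists i, A < h i;
  h_series : forall x : R, 0 < x -> x < 1 ->
    (\sum_(0 <= i <oo) (h i * x ^+ i)%:E < +oo)%E
}.

Definition rho (R : realType) (M : model R) : R := lambda M / mu M.

Definition pi_mu (R : realType) (M : model R) (i : nat) : R :=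
  (1 - rho M) * rho M ^+ i.

Definition Phi (R : realType) (M : model R) : set (state -> R) :=
  [set phi | forall i, (phi (i, true) = mu1 M \/ phi (i, true) = mu2 M) /\
                       phi (i, false) = mu M].

(* For i = 0 the departure term has coefficient 0, so that it does not matter
   that i.-1 = i. *)
Definition trans (R : realType) (M : model R) (phi : state -> R)
    (x y : state) : R :=
  let: (i, q) := x in
  let a := phi x in
  let dep := a * (0 < i)%N%:R in
  if q then
    lambda M * (y == (i.+1, true))%:R + beta M * (y == (i, false))%:R
    + dep * (y == (i.-1, true))%:R
    + (1 - lambda M - beta M - dep) * (y == (i, true))%:R
  else
    lambda M * (y == (i.+1, false))%:R + dep * (y == (i.-1, false))%:R
    + (1 - lambda M - dep) * (y == (i, false))%:R.

Definition step_cost (R : realType) (M : model R) (phi : state -> R)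
    (x : state) : R :=
  cost M (phi x) + h M x.1.

(* Under the probability Q, the sequence Y is a time-homogeneous Markov chain
   started at x0 with transition probabilities p.  The Markov property is
   Q(Y_(n+1) = y | Y_0 = z_0, ..., Y_n = z_n) = p(z_n, y), multiplied by the
   probability of the conditioning event. *)
Definition markov_chain (R : realType) (d : measure_display)
    (Omega : measurableType d) (Q : probability Omega R)
    (Y : nat -> Omega -> state) (x0 : state) (p : state -> state -> R) : Prop :=
  [/\ forall n, measurable_fun [set: Omega] (Y n),
      Q [set w | Y 0%N w = x0] = 1%E &
      forall (n : nat) (z : nat -> state) (y : state),
        Q [set w | (forall m, (m <= n)%N -> Y m w = z m) /\ Y n.+1 w = y] =
        (Q [set w | forall m, (m <= n)%N -> Y m w = z m] * (p (z n) y)%:E)%E].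

(* P phi x is the law usually written P^phi_x; it is constrained only for
   phi in Phi. *)
Definition controlled_chain (R : realType) (M : model R) (d : measure_display)
    (Omega : measurableType d) (Y : nat -> Omega -> state)
    (P : (state -> R) -> state -> probability Omega R) : Prop :=
  forall phi, Phi M phi -> forall x, markov_chain (P phi x) Y x (trans M phi).

Definition Vdisc (R : realType) (M : model R) (d : measure_display)
    (Omega : measurableType d) (Y : nat -> Omega -> state)
    (P : (state -> R) -> state -> probability Omega R)
    (alpha : R) (phi : state -> R) (x : state) : \bar R :=
  (\int[P phi x]_w
     \sum_(0 <= n <oo) ((1 - alpha) ^+ n * step_cost M phi (Y n w))%:E)%E.

Definition saved_cost (R : realType) (M : model R) (d : measure_display)
    (Omega : measurableType d) (Y : nat -> Omega -> state)
    (P : (state -> R) -> state -> probability Omega R)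
    (alpha : R) (phi : state -> R) : \bar R :=
  (\sum_(0 <= i <oo)
     (pi_mu M i)%:E *
     (Vdisc M Y P alpha phi (i, false) - Vdisc M Y P alpha phi (i, true)))%E.

Definition max_saved_cost (R : realType) (M : model R) (d : measure_display)
    (Omega : measurableType d) (Y : nat -> Omega -> state)
    (P : (state -> R) -> state -> probability Omega R) (alpha : R) : \bar R :=
  ereal_sup [set saved_cost M Y P alpha phi | phi in Phi M].

Definition weighted_cost_sup (R : realType) (M : model R) (gamma : R) : \bar R :=
  ereal_sup [set
    ereal_sup [set (`|step_cost M phi x| / gamma ^+ x.1)%:E | x in [set: state]]
    | phi in Phi M].

(* In value iteration (i - 1)^+ is i.-1. *)
Definition VI_action_value (R : realType) (M : model R) (alpha : R)
    (V : state -> R) (i : nat) (a : R) : R :=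
  cost M a + (1 - alpha) * ((a - mu1 M) * V (i.-1, true)
                            + (mu2 M - a) * V (i, true)).

Definition VI_step (R : realType) (M : model R) (alpha : R)
    (V : state -> R) (x : state) : R :=
  let: (i, q) := x in
  if q then
    h M i
    + (1 - alpha) * (mu1 M * V (i, true) + mu1 M * V (i.-1, true)
                     + lambda M * V (i.+1, true) + beta M * V (i, false))
    + Num.min (VI_action_value M alpha V i (mu1 M))
              (VI_action_value M alpha V i (mu2 M))
  else
    cost M (mu M) + h M i
    + (1 - alpha) * (mu M * V (i.-1, false)
                     + (1 - mu M - lambda M) * V (i, false)
                     + lambda M * V (i.+1, false)).

Definition VI (R : realType) (M : model R) (alpha : R) (n : nat) : state -> R :=
  iter n (VI_step M alpha) (fun=> 0).

(* The n-stage optimal policy, meaningful for n >= 1. *)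
Definition VI_policy (R : realType) (M : model R) (alpha : R) (n : nat)
    (x : state) : R :=
  let: (i, q) := x in
  let V := VI M alpha n.-1 in
  if q then
    if VI_action_value M alpha V i (mu1 M) <= VI_action_value M alpha V i (mu2 M)
    then mu1 M else mu2 M
  else mu M.

Definition log_base (R : realType) (b x : R) : R := ln x / ln b.

Definition VI_horizon (R : realType) (alpha gamma uM eps : R) (i : nat) : nat :=
  `|Num.max (1 : int)
      (Num.ceil (log_base ((1 - alpha) * gamma)
         (eps * (1 - (1 - alpha) * gamma) / (2 * uM * gamma ^+ i))))|%N.

Definition truncation_level (R : realType) (M : model R)
    (alpha gamma uM eps : R) : nat :=
  `|Num.max (0 : int)
      (Num.ceil (log_base (gamma * rho M)
         (eps * (1 - gamma * rho M) * (1 - (1 - alpha) * gamma)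
          / (2 * uM * (1 - rho M)))))|%N.

(* Main.v *)
Require Import Defs.
From mathcomp Require Import all_boot all_order all_algebra.
From mathcomp Require Import all_classical all_reals all_analysis.
From mathcomp Require Import esum measurable_realfun lra ring zify.
Import Order.TTheory GRing.Theory Num.Theory.
Import numFieldNormedType.Exports.
Local Open Scope classical_set_scope.
Local Open Scope ring_scope.

Set Implicit Arguments.
Unset Strict Implicit.
Unset Printing Implicit Defensive.

(* The value of a policy phi is the increasing limit of the iterates of
   T_phi f = c^phi + (1 - alpha) Q_phi f started at 0, and T_phi contracts by
   kappa = (1 - alpha) gamma in the norm weighted by gamma^i, because one
   transition multiplies the weight by at most gamma.  Value iteration is
   dominated by every T_phi, so V_n <= V^psi for all psi.  Its n-stage policy
   phi satisfies T_phi V_(n-1) = V_n, and V_n - V_(n-1) is at most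
   kappa^(n-1) u_M gamma^i, whence
   V^phi <= V_n + kappa^n u_M gamma^i / (1 - kappa).
   The values at the states (i, 0) do not depend on the policy, so for every
   psi the saved costs of psi and phi differ by the mean of V^phi - V^psi at
   the states (i, 1) under pi_mu.  The choice of n makes the terms i < k
   contribute at most eps / 2.  For i >= k, the bound
   V^phi <= u_M gamma^i / (1 - kappa) leaves a geometric tail, which the choice
   of k makes at most eps / 2. *)

(** * Transition lists and one-step operators *)

(** With finitely many weighted successors, the mean of a function of the next state is a finite sum
    rather than a series over all states. *)
Definition transitions (R : realType) (M : model R) (phi : state -> R)
    (x : state) : seq (R * state) :=
  let: (i, q) := x in
  let a := phi x in
  if q then
    [:: (lambda M, (i.+1, true)); (beta M, (i, false)); (a, (i.-1, true));
        (1 - lambda M - beta M - a, (i, true))]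
  else
    [:: (lambda M, (i.+1, false)); (a, (i.-1, false));
        (1 - lambda M - a, (i, false))].

Definition kernel_op (R : realType) (L : state -> seq (R * state))
    (f : state -> R) (x : state) : R :=
  \sum_(t <- L x) t.1 * f t.2.

Definition cost_op (R : realType) (M : model R) (alpha : R)
    (phi : state -> R) (f : state -> R) (x : state) : R :=
  step_cost M phi x + (1 - alpha) * kernel_op (transitions M phi) f x.

(** Taking the value function as argument, instead of a stage, separates the minimisation from the
    index shift [n.-1] in [VI_policy]. *)
Definition greedy (R : realType) (M : model R) (alpha : R) (V : state -> R)
    (x : state) : R :=
  let: (i, q) := x in
  if q then
    if VI_action_value M alpha V i (mu1 M) <= VI_action_value M alpha V i (mu2 M)
    then mu1 M else mu2 M
  else mu M.

(** By [horizon_cost_sum] and [VdiscE], these are the partial sums of the series for the discounted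
    value of [phi]. *)
Definition horizon_cost (R : realType) (M : model R) (alpha : R)
    (phi : state -> R) (n : nat) : state -> R :=
  iter n (cost_op M alpha phi) (fun=> 0).

(* For [i = 0] the departure goes from [(0, q)] to itself, so that it merges
   with the self-loop. *)
Lemma transE (R : realType) (M : model R) (phi : state -> R) (x y : state) :
  trans M phi x y = \sum_(t <- transitions M phi x) t.1 * (y == t.2)%:R.
Proof.
by case: x => [[|i] []]; rewrite /trans /transitions !big_cons big_nil /=; ring.
Qed.

Lemma kernel_opE (R : realType) (M : model R) (phi f : state -> R) (i : nat)
    (q : bool) :
  kernel_op (transitions M phi) f (i, q) =
  lambda M * f (i.+1, q) + phi (i, q) * f (i.-1, q) +
  (if q then beta M * f (i, false) + (1 - lambda M - beta M - phi (i, q)) * f (i, q)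
   else (1 - lambda M - phi (i, q)) * f (i, q)).
Proof. by rewrite /kernel_op; case: q; rewrite !big_cons big_nil /=; ring. Qed.

Lemma kernel_opD (R : realType) (L : state -> seq (R * state))
    (f g : state -> R) (x : state) :
  kernel_op L (fun y => f y + g y) x = kernel_op L f x + kernel_op L g x.
Proof. by rewrite -big_split; apply: eq_bigr => t _; rewrite mulrDr. Qed.

Lemma kernel_opZ (R : realType) (L : state -> seq (R * state)) (c : R)
    (f : state -> R) (x : state) :
  kernel_op L (fun y => c * f y) x = c * kernel_op L f x.
Proof. by rewrite big_distrr; apply: eq_bigr => t _; rewrite mulrCA. Qed.

Lemma kernel_op_sum (R : realType) (L : state -> seq (R * state)) (n : nat)
    (f : 'I_n -> state -> R) (x : state) :
  kernel_op L (fun y => \sum_(j < n) f j y) x =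
  \sum_(j < n) kernel_op L (f j) x.
Proof.
by rewrite exchange_big; apply: eq_bigr => t _ /=; rewrite mulr_sumr.
Qed.

(** * Sums and integrals over countably many fibres *)

Lemma esum_single (R : realType) (T : choiceType) (a : T) (F : T -> \bar R) :
  (0 <= F a)%E -> (forall s, s != a -> F s = 0%E) ->
  \esum_(s in [set: T]) F s = F a.
Proof.
move=> F0 Fa; rewrite -(esum_set1 F0) [RHS]esum_mkcond; apply: eq_esum => s _.
case: ifPn => // /negP sa; apply: Fa; apply/eqP => sa'.
by apply: sa; rewrite sa' inE.
Qed.

(** [pickle] is injective, and natural numbers that code no element contribute 0. *)
Lemma esum_pickle (R : realType) (T : countType) (F : T -> \bar R) :
  (forall s, (0 <= F s)%E) ->
  (\sum_(0 <= k <oo) oapp F 0%E (pickle_inv k) = \esum_(s in [set: T]) F s)%E.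
Proof.
move=> F0; rewrite nneseries_esumT; last first.
  by move=> n; case: pickle_inv => //=.
have -> : \esum_(s in [set: T]) F s =
    \esum_(s in [set: T]) oapp F 0%E (pickle_inv (pickle s)).
  by apply: eq_esum => s _; rewrite pickleK_inv.
rewrite -(@esum_image _ _ _ [set: T] (@pickle T)
    (fun k => oapp F 0%E (pickle_inv k))); last first.
  by move=> s t _ _; exact: (pcan_inj (@pickleK T)).
rewrite [RHS]esum_mkcond; apply: eq_esum => k _.
case: ifPn => //; have := @pickle_invK T k.
by case: pickle_inv => //= s sk /negP[]; rewrite inE; exists s.
Qed.

(** Every preimage is a countable union of fibres. [T] carries no sigma-algebra here, so the lemma
    applies to histories as well as to states. *)
Lemma fibers_measurable (d : measure_display) (Omega : measurableType d)
    (T : countType) (Z : Omega -> T) :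
  (forall s, measurable (Z @^-1` [set s])) ->
  forall A : set T, measurable (Z @^-1` A).
Proof.
move=> mZ A.
have -> : Z @^-1` A = \bigcup_k
    (if pickle_inv k is Some s then [set w | A s /\ Z w = s] else set0).
  apply/seteqP; split=> [w Aw|w [k _]].
    by exists (pickle (Z w)) => //=; rewrite pickleK_inv.
  by case: pickle_inv => //= s [As ->].
apply: bigcup_measurable => k _; case: pickle_inv => [s|]; last exact: measurable0.
have [As|nAs] := pselect (A s).
  rewrite (_ : [set _ | _] = Z @^-1` [set s]) //.
  by apply/seteqP; split=> w //= [].
by rewrite (_ : [set _ | _] = set0) //; apply/seteqP; split=> w //= [].
Qed.

Lemma fibers_measurable_fun (d : measure_display) (Omega : measurableType d)
    (T : countType) (Z : Omega -> T) :
  (forall s, measurable (Z @^-1` [set s])) ->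
  forall (d' : measure_display) (U : measurableType d') (f : T -> U)
    (D : set Omega), measurable_fun D (fun w => f (Z w)).
Proof.
move=> mZ d' U f D mD B mB; apply: measurableI => //.
exact: (fibers_measurable mZ (f @^-1` B)).
Qed.

Lemma integral_fibers (R : realType) (d : measure_display)
    (Omega : measurableType d) (mu : measure Omega R) (T : countType)
    (Z : Omega -> T) (D : set Omega) (g : Omega -> \bar R) :
  (forall s, measurable (Z @^-1` [set s])) -> measurable D ->
  measurable_fun D g -> (forall w, (0 <= g w)%E) ->
  (\int[mu]_(w in D) g w =
   esum [set: T] (fun s => \int[mu]_(w in D `&` Z @^-1` [set s]) g w))%E.
Proof.
move=> mZ mD mg g0.
pose F k := D `&` (fun w => pickle (Z w)) @^-1` [set k].
have mF k : measurable (F k).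
  apply: measurableI => //.
  exact: (fibers_measurable mZ (pickle @^-1` [set k])).
have DF : D = \bigcup_k F k.
  apply/seteqP; split=> [w Dw|w [k _ []]] //.
  by exists (pickle (Z w)).
rewrite {1}DF ge0_integral_bigcup //.
- rewrite -esum_pickle; last by move=> s; exact: integral_ge0.
  apply: eq_eseriesr => k _; rewrite /F.
  case E : (pickle_inv k) => [s|] /=; have := @pickle_invK T k; rewrite E /=.
    move=> sk; congr integral; congr (_ `&` _); apply/seteqP.
    split=> w /=; last by move=> ->.
    by rewrite -sk => /(pcan_inj (@pickleK T)).
  rewrite (_ : _ `&` _ = set0) ?integral_set0 //.
  apply/seteqP; split=> w //= [_ wk]; move: E.
  by rewrite -wk pickleK_inv.
- by rewrite -DF.
- by move=> i j _ _ [w [[_ <-] [_ <-]]].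
Qed.

Lemma integral_fun_fibers (R : realType) (d : measure_display)
    (Omega : measurableType d) (mu : measure Omega R) (T : countType)
    (Z : Omega -> T) (D : set Omega) (f : T -> R) :
  (forall s, measurable (Z @^-1` [set s])) -> measurable D ->
  (forall s, 0 <= f s) ->
  (\int[mu]_(w in D) (f (Z w))%:E =
   \esum_(s in [set: T]) ((f s)%:E * mu (D `&` Z @^-1` [set s])))%E.
Proof.
move=> mZ mD f0; rewrite (integral_fibers _ mZ mD); last 2 first.
- exact: (fibers_measurable_fun mZ (fun s => (f s)%:E)).
- by move=> w; rewrite lee_fin.
apply: eq_esum => s _; rewrite -integral_cst; last exact: measurableI.
by apply: eq_integral => w; rewrite inE => -[_ /= ->].
Qed.

(** * Expectations along the Markov chain *)

Section chain.
Variables (R : realType) (d : measure_display) (Omega : measurableType d)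
  (Q : probability Omega R) (Y : nat -> Omega -> state) (x0 : state)
  (p : state -> state -> R) (L : state -> seq (R * state)).
Hypothesis hY : markov_chain Q Y x0 p.
Hypothesis pE : forall x y, p x y = \sum_(t <- L x) t.1 * (y == t.2)%:R.
Hypothesis L0 : forall x t, t \in L x -> 0 <= t.1.

Lemma chain_fiber_measurable n s : measurable (Y n @^-1` [set s]).
Proof.
case: hY => mY _ _; rewrite -[X in measurable X]setTI; apply: mY => //.
case: s => i q.
rewrite (_ : [set (i, q)] = [set i] `*` [set q]); first exact: measurableX.
by apply/seteqP; split=> -[j r] /=; [case=> -> ->|case=> /= -> ->].
Qed.

(** Lists of states form a countable type, so the fibres of [history n] partition the sample space
    into countably many events. *)
Definition history n w := [seq Y m w | m <- iota 0 n.+1].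

Lemma history_eq n (w : Omega) (t : seq state) :
  history n w = t <->
  size t = n.+1 /\ (forall m, (m <= n)%N -> Y m w = nth (0%N, false) t m).
Proof.
split=> [<-|[st h]]; rewrite /history.
  rewrite size_map size_iota; split=> // m mn.
  by rewrite (nth_map 0%N) ?size_iota // nth_iota.
apply: (@eq_from_nth _ (0%N, false)); rewrite size_map size_iota // => m mn.
by rewrite (nth_map 0%N) ?size_iota // nth_iota // add0n h.
Qed.

Lemma history_fiber n (t : seq state) : history n @^-1` [set t] =
  if size t == n.+1
  then [set w | forall m, (m <= n)%N -> Y m w = nth (0%N, false) t m]
  else set0.
Proof.
case: eqP => st; apply/seteqP; split=> w //=; rewrite history_eq; by [case|].
Qed.

Lemma history_fiber_measurable n (t : seq state) :
  measurable (history n @^-1` [set t]).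
Proof.
rewrite history_fiber; case: ifP => _; last exact: measurable0.
rewrite (_ : [set w | _] =
    \bigcap_(m in `I_n.+1) (Y m @^-1` [set nth (0%N, false) t m])).
  apply: bigcap_measurable => [|m _]; first by exists 0%N.
  exact: chain_fiber_measurable.
by apply/seteqP; split=> w /= h m; apply: h.
Qed.

Lemma history_last n w : last (0%N, false) (history n w) = Y n w.
Proof. by rewrite /history -[n.+1]addn1 iotaD map_cat last_cat. Qed.

Lemma kernel_op_ge0 f x : (forall s, 0 <= f s) -> 0 <= kernel_op L f x.
Proof.
move=> f0; rewrite /kernel_op big_seq; apply: sumr_ge0 => t tL.
by rewrite mulr_ge0 // (L0 tL).
Qed.

(* The Markov property is only given for complete histories, so the expectation
   is split over all histories up to time n rather than over the state at n. *)
Lemma integral_history_step n t f : (forall s, 0 <= f s) ->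
  (\int[Q]_(w in history n @^-1` [set t]) (f (Y n.+1 w))%:E =
   \int[Q]_(w in history n @^-1` [set t]) (kernel_op L f (Y n w))%:E)%E.
Proof.
move=> f0.
rewrite (integral_fun_fibers Q (chain_fiber_measurable n.+1)) //; last first.
  exact: history_fiber_measurable.
(* On a history fibre [Y n] is the last entry of [t], so the integrand on the right is constant. *)
transitivity (\int[Q]_(w in history n @^-1` [set t])
    cst (kernel_op L f (last (0%N, false) t))%:E w)%E; last first.
  by apply: eq_integral => w; rewrite inE /= => <-; rewrite history_last.
rewrite integral_cst; last exact: history_fiber_measurable.
have [st|nst] := eqVneq (size t) n.+1; last first.
  rewrite history_fiber (negbTE nst) measure0 mule0 esum1 // => s _.
  by rewrite set0I measure0 mule0.
set z := last _ _.
have QE s : Q (history n @^-1` [set t] `&` Y n.+1 @^-1` [set s]) =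
    (Q (history n @^-1` [set t]) * (p z s)%:E)%E.
  case: hY => _ _ /(_ n (nth (0%N, false) t) s).
  rewrite history_fiber st eqxx -(_ : z = nth (0%N, false) t n) //.
  by rewrite /z -nth_last st.
have Qf : Q (history n @^-1` [set t]) \is a fin_num.
  by apply: fin_num_measure; exact: history_fiber_measurable.
set q := fine (Q (history n @^-1` [set t])).
have Qq : Q (history n @^-1` [set t]) = q%:E by rewrite fineK.
have q0 : 0 <= q by rewrite fine_ge0.
(* The membership condition stays in the inner sum because weights are known to be nonnegative only
   for entries of [L z]; nonnegativity permits the exchange of sums. *)
transitivity (\esum_(s in [set: state]) \sum_(u <- L z | u \in L z)
   (q * (u.1 * (s == u.2)%:R * f s))%:E)%E.
  apply: eq_esum => s _; rewrite [X in (_ * X)%E](QE s).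
  rewrite [X in (_ * (X * _))%E]Qq -!EFinM pE sumEFin -big_seq.
  by rewrite -mulr_sumr -mulr_suml; congr EFin; rewrite mulrC -mulrA.
rewrite esum_sum; last first.
  by move=> s u _ uL; rewrite lee_fin !mulr_ge0 // (L0 uL).
rewrite [X in (_ * X)%E]Qq -EFinM /kernel_op mulr_suml -sumEFin [RHS]big_seq.
apply: eq_bigr => u uL; rewrite (@esum_single _ _ u.2).
- by rewrite eqxx mulr1 mulrC.
- by rewrite lee_fin !mulr_ge0 // (L0 uL).
- by move=> s /negbTE ->; rewrite mulr0 mul0r mulr0.
Qed.

Lemma expectation_step n f : (forall s, 0 <= f s) ->
  (\int[Q]_w (f (Y n.+1 w))%:E = \int[Q]_w (kernel_op L f (Y n w))%:E)%E.
Proof.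
move=> f0.
have mY m (g : state -> R) : measurable_fun [set: Omega] (fun w => (g (Y m w))%:E).
  exact: (fibers_measurable_fun (chain_fiber_measurable m) (fun s => (g s)%:E)).
rewrite (integral_fibers Q (@history_fiber_measurable n)) //; last first.
  by move=> w; rewrite lee_fin.
rewrite [RHS](integral_fibers Q (@history_fiber_measurable n)) //; last first.
  by move=> w; rewrite lee_fin kernel_op_ge0.
by apply: eq_esum => t _; rewrite !setTI integral_history_step.
Qed.

Lemma expectation_start f : (forall s, 0 <= f s) ->
  (\int[Q]_w (f (Y 0%N w))%:E = (f x0)%:E)%E.
Proof.
move=> f0; have mY := chain_fiber_measurable 0.
rewrite (integral_fun_fibers Q mY) //.
have Q1 : Q (Y 0%N @^-1` [set x0]) = 1%E by case: hY.
rewrite (@esum_single _ _ x0); first by rewrite setTI [X in (_ * X)%E]Q1 mule1.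
  by rewrite mule_ge0 // lee_fin.
move=> s sx0; rewrite setTI [X in (_ * X)%E](_ : _ = 0%E) ?mule0 //.
apply/eqP; rewrite -measure_le0.
apply: (@le_trans _ _ (Q (~` (Y 0%N @^-1` [set x0])))).
  apply: le_measure; rewrite ?inE //; first exact: measurableC.
  by move=> w /= -> /eqP; rewrite (negbTE sx0).
by rewrite probability_setC // Q1 subee.
Qed.

(** Each step back in time costs one application of the kernel to [f], so the induction must be
    general in [f]. *)
Lemma expectation_iter n f : (forall s, 0 <= f s) ->
  (\int[Q]_w (f (Y n w))%:E = (iter n (kernel_op L) f x0)%:E)%E.
Proof.
elim: n f => [|n IH] f f0; first exact: expectation_start.
rewrite expectation_step // IH; last by move=> s; exact: kernel_op_ge0.
by rewrite -iterSr.
Qed.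
End chain.

(** * Admissible policies and value iteration *)

Lemma horizon_costS (R : realType) (M : model R) (alpha : R)
    (phi : state -> R) (n : nat) :
  horizon_cost M alpha phi n.+1 =
  cost_op M alpha phi (horizon_cost M alpha phi n).
Proof. by []. Qed.

Lemma mu_le_mu2 (R : realType) (M : model R) : mu M <= mu2 M.
Proof. by case: (mu_in M) => ->; rewrite // ltW // mu1_lt_mu2. Qed.

Lemma mu_gt0 (R : realType) (M : model R) : 0 < mu M.
Proof. exact: lt_trans (lambda_gt0 M) (lambda_lt_mu M). Qed.

Lemma Phi_rate (R : realType) (M : model R) (phi : state -> R) (x : state) :
  Phi M phi -> 0 < phi x <= mu2 M.
Proof.
have := mu1_gt0 M; have := mu1_lt_mu2 M; have := mu_gt0 M; have := mu_le_mu2 M.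
case: x => i [] ? ? ? ? /(_ i) /= [hc hf]; last by rewrite hf; lra.
by case: hc => ->; lra.
Qed.

(** Only the self-loops need an argument: rates are at most [mu2 M], so by [rates_sum1] the
    self-loop weights stay at least [mu1 M]. *)
Lemma transitions_ge0 (R : realType) (M : model R) (phi : state -> R)
    (x : state) (t : R * state) :
  Phi M phi -> t \in transitions M phi x -> 0 <= t.1.
Proof.
move=> hphi; have := Phi_rate x hphi.
have := lambda_gt0 M; have := beta_gt0 M; have := mu1_gt0 M.
have := rates_sum1 M; case: x => i [] ? ? ? ? /andP[? ?];
  rewrite !inE => /predU1P[->|/predU1P[->|]] /=; try lra;
  [case/predU1P=> [->|/eqP ->] /=; lra|move/eqP=> -> /=; lra].
Qed.

Lemma Phi_cost_ge0 (R : realType) (M : model R) (phi : state -> R)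
    (x : state) : Phi M phi -> 0 <= step_cost M phi x.
Proof.
move=> hphi; rewrite /step_cost addr_ge0 ?h_ge0 //.
have c2 := ltW (cost_mu2 M); have c1 := cost_mu1 M.
case: x => i q; have [hc hf] := hphi i; case: q.
  by case: hc => ->; rewrite ?c1.
by rewrite hf; case: (mu_in M) => ->; rewrite ?c1.
Qed.

Lemma greedy_Phi (R : realType) (M : model R) (alpha : R) (V : state -> R) :
  Phi M (greedy M alpha V).
Proof. by move=> i; split=> //=; case: ifP => _; [left|right]. Qed.

(** By [rates_sum1] the self-loop weight is [mu1 + (mu2 - a)], which isolates the part depending on
    the action [a]. *)
Lemma cost_op_ctrl (R : realType) (M : model R) (alpha : R)
    (phi V : state -> R) (i : nat) :
  cost_op M alpha phi V (i, true) =
  h M i + (1 - alpha) * (mu1 M * V (i, true) + mu1 M * V (i.-1, true)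
                     + lambda M * V (i.+1, true) + beta M * V (i, false))
  + VI_action_value M alpha V i (phi (i, true)).
Proof.
rewrite /cost_op kernel_opE /step_cost /VI_action_value /= -(rates_sum1 M).
ring.
Qed.

Lemma cost_op_fixed (R : realType) (M : model R) (alpha : R)
    (phi V : state -> R) (i : nat) : Phi M phi ->
  cost_op M alpha phi V (i, false) = VI_step M alpha V (i, false).
Proof.
move=> /(_ i) [_ hf].
by rewrite /cost_op kernel_opE /step_cost /= hf; ring.
Qed.

Lemma VI_step_le (R : realType) (M : model R) (alpha : R)
    (phi V : state -> R) (x : state) : Phi M phi ->
  VI_step M alpha V x <= cost_op M alpha phi V x.
Proof.
case: x => i [] hphi; last by rewrite cost_op_fixed.
rewrite cost_op_ctrl /= lerD2l; have [hc _] := hphi i.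
by case: hc => ->; rewrite ge_min lexx ?orbT.
Qed.

Lemma VI_step_greedy (R : realType) (M : model R) (alpha : R)
    (V : state -> R) (x : state) :
  VI_step M alpha V x = cost_op M alpha (greedy M alpha V) V x.
Proof.
case: x => i [].
  rewrite cost_op_ctrl /greedy /VI_step; congr (_ + _).
  by case: ifPn => [/min_idPl -> //|]; rewrite -ltNge => /ltW /min_idPr ->.
by rewrite cost_op_fixed //; exact: greedy_Phi.
Qed.

Lemma kernel_op_le (R : realType) (M : model R) (phi f g : state -> R)
    (x : state) : Phi M phi -> (forall y, f y <= g y) ->
  kernel_op (transitions M phi) f x <= kernel_op (transitions M phi) g x.
Proof.
move=> hphi fg; rewrite /kernel_op big_seq [leRHS]big_seq.
by apply: ler_sum => t tL; rewrite ler_wpM2l // (transitions_ge0 hphi tL).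
Qed.

(** The queue grows by at most one per transition, and the weights of the list sum to 1. *)
Lemma kernel_op_weight (R : realType) (M : model R) (phi : state -> R)
    (gamma : R) (x : state) : Phi M phi -> 1 <= gamma ->
  kernel_op (transitions M phi) (fun y => gamma ^+ y.1) x <=
  gamma * gamma ^+ x.1.
Proof.
move=> hphi g1; rewrite -exprS /kernel_op.
apply: (@le_trans _ _ (\sum_(t <- transitions M phi x) t.1 * gamma ^+ x.1.+1)).
  rewrite big_seq [leRHS]big_seq; apply: ler_sum => t tL.
  rewrite ler_wpM2l ?(transitions_ge0 hphi tL) //; apply: ler_weXn2l => //.
  move: tL; case: x => i [];
    rewrite !inE => /predU1P[->|/predU1P[->|]] //=; try lia;
    [case/predU1P=> [->|/eqP ->] /=; lia|move/eqP=> -> /=; lia].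
rewrite -mulr_suml -[leRHS]mul1r le_eqVlt; apply/orP; left; apply/eqP.
by congr (_ * _); case: x => i []; rewrite !big_cons big_nil /=; ring.
Qed.

(** * Contraction estimates in the weighted norm *)

Section discount.
Variables (R : realType) (M : model R) (alpha gamma u : R).
Hypotheses (a1 : alpha < 1) (g1 : 1 < gamma).
Hypothesis kappa1 : (1 - alpha) * gamma < 1.
Hypothesis u0 : 0 < u.
Hypothesis hu : forall phi x, Phi M phi -> step_cost M phi x <= u * gamma ^+ x.1.

Let kappa := (1 - alpha) * gamma.
Let w (x : state) := gamma ^+ x.1.

(** A one-sided contraction: only upper bounds are propagated below, and no norm on unbounded
    functions has to be set up. The case [e = 0] is monotonicity. *)
Lemma cost_op_le phi f g e x : Phi M phi -> 0 <= e ->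
  (forall y, f y <= g y + e * w y) ->
  cost_op M alpha phi f x <= cost_op M alpha phi g x + kappa * e * w x.
Proof.
move=> hphi e0 fg; rewrite /cost_op -[leRHS]addrA lerD2l.
have h1 := kernel_op_le x hphi fg.
rewrite kernel_opD kernel_opZ in h1.
have h2 := kernel_op_weight x hphi (ltW g1).
apply: (@le_trans _ _ ((1 - alpha) * (kernel_op (transitions M phi) g x
    + e * (gamma * gamma ^+ x.1)))).
  rewrite ler_wpM2l ?subr_ge0 ?(ltW a1) //; apply: le_trans h1 _.
  by rewrite lerD2l ler_wpM2l.
by rewrite mulrDr lerD2l /kappa /w le_eqVlt; apply/orP; left; apply/eqP; ring.
Qed.

Lemma cost_op_homo phi f g x : Phi M phi -> (forall y, f y <= g y) ->
  cost_op M alpha phi f x <= cost_op M alpha phi g x.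
Proof.
move=> hphi fg; have := @cost_op_le phi f g 0 x hphi (lexx _).
by rewrite mulr0 mul0r addr0; apply=> y; rewrite mul0r addr0.
Qed.

Lemma VI_le_horizon phi n x : Phi M phi ->
  VI M alpha n x <= horizon_cost M alpha phi n x.
Proof.
move=> hphi; elim: n x => [|n IH] x //.
apply: le_trans (VI_step_le _ _ _ hphi) _.
exact: cost_op_homo.
Qed.

Lemma kappa_ge0 : 0 <= kappa.
Proof. by rewrite mulr_ge0 ?subr_ge0 ?(ltW a1) // ltW // (lt_trans _ g1). Qed.

(** The policy greedy for [V_n] reproduces [V_(n+1)] from [V_n] exactly, and applied to [V_(n+1)] it
    can only overestimate [V_(n+2)]. The contraction of this single policy operator then passes the
    bound on. *)
Lemma VI_increment n x :
  VI M alpha n.+1 x <= VI M alpha n x + kappa ^+ n * u * w x.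
Proof.
elim: n x => [|n IH] x.
  have hphi := greedy_Phi M alpha (fun=> 0).
  rewrite [VI M alpha 1](_ : _ = VI_step M alpha (fun=> 0)) // VI_step_greedy.
  rewrite expr0 mul1r add0r /cost_op /kernel_op big1 => [|t _].
    by rewrite mulr0 addr0 hu.
  by rewrite mulr0.
rewrite [VI M alpha n.+2](_ : _ = VI_step M alpha (VI M alpha n.+1)) //.
rewrite [VI M alpha n.+1 x](_ : _ = VI_step M alpha (VI M alpha n) x) //.
have hphi := greedy_Phi M alpha (VI M alpha n).
apply: le_trans (VI_step_le _ _ _ hphi) _.
rewrite VI_step_greedy exprS -[kappa * _ * u]mulrA; apply: cost_op_le => //.
by rewrite mulr_ge0 ?exprn_ge0 ?kappa_ge0 // ltW.
Qed.

(** The bound is uniform in [m], so it survives the limit. Its constant [e] solves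
    [e = kappa * (kappa ^+ n * u) + kappa * e]: the first term is the cost of replacing [V_(n+1)] by
    [V_n] under the operator, the second the contracted error of the induction hypothesis. *)
Lemma horizon_le_VI n m x :
  horizon_cost M alpha (greedy M alpha (VI M alpha n)) m x <=
  VI M alpha n.+1 x + kappa ^+ n.+1 * u / (1 - kappa) * w x.
Proof.
have k1 : 0 < 1 - kappa by rewrite subr_gt0.
have hphi := greedy_Phi M alpha (VI M alpha n).
have c0 j : 0 <= kappa ^+ j * u by rewrite mulr_ge0 ?exprn_ge0 ?kappa_ge0 // ltW.
have w0 y : 0 <= w y by rewrite exprn_ge0 // (le_trans ler01 (ltW g1)).
set e := kappa ^+ n.+1 * u / (1 - kappa).
have e0 : 0 <= e by rewrite divr_ge0 // ltW.
have eE : e = kappa * (kappa ^+ n * u) + kappa * e.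
  by rewrite /e exprS; field; rewrite gt_eqF.
elim: m x => [|m IH] x.
  (* For [m = 0] the left side is 0, and nonnegativity of the value iterates suffices. *)
  rewrite addr_ge0 //; last exact: mulr_ge0.
  have : forall j y, 0 <= VI M alpha j y.
    elim=> // j IHj y.
    rewrite [VI M alpha j.+1 y](_ : _ = VI_step M alpha (VI M alpha j) y) //.
    rewrite VI_step_greedy.
    apply: le_trans (cost_op_homo _ (greedy_Phi _ _ _) IHj).
    rewrite /cost_op /kernel_op big1 => [|t _]; last by rewrite mulr0.
    by rewrite mulr0 addr0 Phi_cost_ge0 //; exact: greedy_Phi.
  exact.
rewrite horizon_costS.
apply: le_trans (cost_op_le x hphi e0 IH) _.
have -> : VI M alpha n.+1 x + e * w x =
    VI M alpha n.+1 x + kappa * (kappa ^+ n * u) * w x + kappa * e * w x.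
  by rewrite {1}eE mulrDl addrA.
rewrite lerD2r [X in _ <= X + _](VI_step_greedy M alpha (VI M alpha n) x).
apply: cost_op_le => // y; exact: VI_increment.
Qed.

Lemma horizon_le_weight phi m x : Phi M phi ->
  horizon_cost M alpha phi m x <= u / (1 - kappa) * w x.
Proof.
move=> hphi; have k1 : 0 < 1 - kappa by rewrite subr_gt0.
have w0 y : 0 <= w y by rewrite exprn_ge0 // (le_trans ler01 (ltW g1)).
set e := u / (1 - kappa).
have e0 : 0 <= e by rewrite divr_ge0 // ltW.
have eE : e = u + kappa * e by rewrite /e; field; rewrite gt_eqF.
elim: m x => [|m IH] x; first by rewrite mulr_ge0.
rewrite horizon_costS.
(* Compare with the zero function, on which [cost_op] leaves only the step cost; [e] is the fixed
   point of [e = u + kappa * e]. *)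
have IH' y : horizon_cost M alpha phi m y <= (fun=> 0) y + e * w y.
  by rewrite add0r.
apply: le_trans (cost_op_le x hphi e0 IH') _.
rewrite /cost_op /kernel_op big1 => [|t _]; last by rewrite mulr0.
by rewrite mulr0 addr0 [e in leRHS]eE mulrDl lerD2r hu.
Qed.
End discount.

(** * Discounted values as series, and logarithmic exponents *)

Lemma horizon_cost_sum (R : realType) (M : model R) (alpha : R)
    (phi : state -> R) (m : nat) (x : state) :
  horizon_cost M alpha phi m x = \sum_(n < m)
    (1 - alpha) ^+ n * iter n (kernel_op (transitions M phi)) (step_cost M phi) x.
Proof.
elim: m x => [|m IH] x; first by rewrite big_ord0.
rewrite horizon_costS (funext IH).
rewrite big_ord_recl expr0 mul1r /cost_op kernel_op_sum mulr_sumr.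
by congr (_ + _); apply: eq_bigr => j _; rewrite kernel_opZ mulrA exprS.
Qed.

(** The states [(j, false)] form a closed class, and all admissible policies agree on it. *)
Lemma fixed_iter_unique (R : realType) (M : model R) (phi phi' : state -> R)
    (n i : nat) : Phi M phi -> Phi M phi' ->
  iter n (kernel_op (transitions M phi)) (step_cost M phi) (i, false) =
  iter n (kernel_op (transitions M phi')) (step_cost M phi') (i, false).
Proof.
move=> hphi hphi'; have e j : phi (j, false) = phi' (j, false).
  by rewrite (hphi j).2 (hphi' j).2.
elim: n i => [|n IH] i; first by rewrite /= /step_cost e.
by rewrite /= !kernel_opE e !IH.
Qed.

Lemma expn_le_of_log_base (R : realType) (b x : R) (n : nat) :
  0 < b -> b < 1 -> 0 < x -> log_base b x <= n%:R -> b ^+ n <= x.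
Proof.
move=> b0 b1 x0; rewrite /log_base => h.
have lb : ln b < 0 by rewrite ln_lt0 // b0.
rewrite -ler_ln ?posrE ?exprn_gt0 // lnXn //.
by rewrite ler_ndivrMr // mulr_natl in h.
Qed.

(** The parameter [m] covers both defaults, 0 for the truncation level and 1 for the horizon. The
    maximum and the absolute value can only enlarge the exponent, which is harmless for a base below
    1. *)
Lemma expn_ceil_log_base (R : realType) (b x : R) (m : int) :
  0 < b -> b < 1 -> 0 < x ->
  b ^+ `|Num.max m (Num.ceil (log_base b x))|%N <= x.
Proof.
move=> b0 b1 x0; apply: expn_le_of_log_base => //.
rewrite natr_absz; apply: le_trans (ceil_ge _) _.
by rewrite ler_int (le_trans _ (ler_norm _)) // le_max lexx orbT.
Qed.

Lemma iter_kernel_opZ (R : realType) (L : state -> seq (R * state)) (c : R)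
    (f : state -> R) (n : nat) (x : state) :
  iter n (kernel_op L) (fun y => c * f y) x = c * iter n (kernel_op L) f x.
Proof.
by elim: n x => // n IH x; rewrite !iterS (funext IH) kernel_opZ.
Qed.

Lemma discounted_cost_ge0 (R : realType) (M : model R) (alpha : R)
    (phi : state -> R) (n : nat) (x : state) : alpha < 1 -> Phi M phi ->
  0 <= (1 - alpha) ^+ n *
    iter n (kernel_op (transitions M phi)) (step_cost M phi) x.
Proof.
move=> alpha1 hphi; rewrite mulr_ge0 ?exprn_ge0 ?subr_ge0 ?(ltW alpha1) //.
elim: n x => [|n IH] x; first exact: Phi_cost_ge0.
by rewrite iterS; apply: kernel_op_ge0 => // s t; exact: transitions_ge0.
Qed.

(** Nonnegative costs let expectation and series be exchanged before finiteness of the value is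
    known. *)
Lemma VdiscE (R : realType) (M : model R) (d : measure_display)
    (Omega : measurableType d) (Y : nat -> Omega -> state)
    (P : (state -> R) -> state -> probability Omega R)
    (hP : controlled_chain M Y P) (alpha : R) (alpha1 : alpha < 1)
    (phi : state -> R) (hphi : Phi M phi) (x : state) :
  (Vdisc M Y P alpha phi x = \sum_(0 <= n <oo) ((1 - alpha) ^+ n *
     iter n (kernel_op (transitions M phi)) (step_cost M phi) x)%:E)%E.
Proof.
have c0 n s : 0 <= (1 - alpha) ^+ n * step_cost M phi s.
  by rewrite mulr_ge0 ?Phi_cost_ge0 // exprn_ge0 // subr_ge0 ltW.
rewrite /Vdisc integral_nneseries //.
- apply: eq_eseriesr => n _.
  rewrite (expectation_iter (hP phi hphi x) (transE M phi) _ n (c0 n)).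
    by rewrite iter_kernel_opZ.
  by move=> s t; exact: transitions_ge0.
- move=> n.
  exact: (fibers_measurable_fun (chain_fiber_measurable (hP phi hphi x) n)
    (fun s => ((1 - alpha) ^+ n * step_cost M phi s)%:E)).
- by move=> n w _; rewrite lee_fin.
Qed.

Lemma horizon_le_Vdisc (R : realType) (M : model R) (d : measure_display)
    (Omega : measurableType d) (Y : nat -> Omega -> state)
    (P : (state -> R) -> state -> probability Omega R)
    (hP : controlled_chain M Y P) (alpha : R) (alpha1 : alpha < 1)
    (phi : state -> R) (hphi : Phi M phi) (m : nat) (x : state) :
  ((horizon_cost M alpha phi m x)%:E <= Vdisc M Y P alpha phi x)%E.
Proof.
rewrite VdiscE // horizon_cost_sum -sumEFin.
apply: le_trans (nneseries_lim_ge m _); first by rewrite big_mkord.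
by move=> n _ _; rewrite lee_fin discounted_cost_ge0.
Qed.

Lemma Vdisc_le (R : realType) (M : model R) (d : measure_display)
    (Omega : measurableType d) (Y : nat -> Omega -> state)
    (P : (state -> R) -> state -> probability Omega R)
    (hP : controlled_chain M Y P) (alpha : R) (alpha1 : alpha < 1)
    (phi : state -> R) (hphi : Phi M phi) (x : state) (c : R) :
  (forall m, horizon_cost M alpha phi m x <= c) ->
  (Vdisc M Y P alpha phi x <= c%:E)%E.
Proof.
move=> hc; rewrite VdiscE //; apply: lime_le.
  by apply: is_cvg_nneseries => n _ _; rewrite lee_fin discounted_cost_ge0.
by apply: nearW => m; rewrite sumEFin lee_fin big_mkord -horizon_cost_sum.
Qed.

(** * Comparison of series and geometric sums *)

(** The terms have no fixed sign; convergence of both series allows the limits to be subtracted in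
    the reals. Bounding partial sums leaves room for an error spread unevenly over the terms. *)
Lemma eseries_le (R : realType) (a b : R ^nat) (e : R) :
  cvgn (series a) -> cvgn (series b) ->
  (forall n, \sum_(i < n) (a i - b i) <= e) ->
  (\sum_(0 <= i <oo) (a i)%:E <= \sum_(0 <= i <oo) (b i)%:E + e%:E)%E.
Proof.
have eseriesE (f : R ^nat) : cvgn (series f) ->
    (\sum_(0 <= i <oo) (f i)%:E = (limn (series f))%:E)%E.
  move=> cf; rewrite -EFin_lim //; congr (limn _).
  by apply/funext => n; rewrite sumEFin.
move=> ca cb hab; rewrite !eseriesE // -EFinD lee_fin -lerBlDl -limB //.
apply: limr_le; first exact: is_cvgB.
apply: nearW => n;
rewrite [leLHS](_ : _ = \sum_(0 <= i < n) a i - \sum_(0 <= i < n) b i) //.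
by rewrite !big_mkord -sumrB.
Qed.

Lemma cvg_series_geometric_bound (R : realType) (a : R ^nat) (C r : R) :
  0 <= r -> r < 1 -> (forall n, `|a n| <= C * r ^+ n) -> cvgn (series a).
Proof.
move=> r0 r1 ha; apply: normed_cvg.
apply: (@series_le_cvg _ _ (geometric C r)) => //.
- by move=> n; exact: normr_ge0.
- by move=> n; exact: le_trans (normr_ge0 _) (ha n).
- by apply: is_cvg_geometric_series; rewrite ger0_norm.
Qed.

Lemma geometric_sum (R : comPzRingType) (r : R) (n : nat) :
  \sum_(i < n) (1 - r) * r ^+ i = 1 - r ^+ n.
Proof.
elim: n => [|n IH]; first by rewrite big_ord0 expr0 subrr.
by rewrite big_ord_recr /= IH exprS; ring.
Qed.

Lemma geometric_tail_sum (R : realDomainType) (r : R) (k n : nat) :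
  0 <= r -> \sum_(i < n) (if (i < k)%N then 0 else (1 - r) * r ^+ i) <= r ^+ k.
Proof.
move=> r0.
(* Adding the remainder [r ^+ n] once [n] has reached [k] turns the inequality into an exact
   identity, which induction can prove. *)
suff : \sum_(i < n) (if (i < k)%N then 0 else (1 - r) * r ^+ i) +
    (if (n < k)%N then 0 else r ^+ n) = (if (n < k)%N then 0 else r ^+ k).
  by case: ifP => _ h; have := exprn_ge0 k r0; have := exprn_ge0 n r0; lra.
elim: n => [|n IH]; first by rewrite big_ord0 add0r; case: k.
rewrite big_ord_recr /=; move: IH; set S := \sum_(i < n) _.
have [nk|nk|nk] := ltngtP n.+1 k.
- by rewrite !addr0.
- by rewrite exprS => <-; ring.
- by rewrite addr0 nk => ->; rewrite add0r.
Qed.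

(** * Epsilon-optimality of the value iteration policy *)

Lemma weighted_cost_sup_le (R : realType) (M : model R) (gamma u : R)
    (phi : state -> R) (x : state) : 0 < gamma ->
  (weighted_cost_sup M gamma <= u%:E)%E -> Phi M phi ->
  step_cost M phi x <= u * gamma ^+ x.1.
Proof.
move=> g0 hu hphi; apply: le_trans (ler_norm _) _.
rewrite -ler_pdivrMr ?exprn_gt0 // -lee_fin; apply: le_trans hu.
rewrite /weighted_cost_sup.
apply: le_trans (ereal_sup_ubound _); last by exists phi.
by apply: ereal_sup_ubound; exists x.
Qed.

Lemma VI_policyE (R : realType) (M : model R) (alpha : R) (n : nat) :
  VI_policy M alpha n.+1 = greedy M alpha (VI M alpha n).
Proof. by apply/funext => -[i q]. Qed.

Theorem proposition6p1 (R : realType) (M : model R)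
    (d : measure_display) (Omega : measurableType d)
    (Y : nat -> Omega -> state)
    (P : (state -> R) -> state -> probability Omega R)
    (hP : controlled_chain M Y P)
    (alpha gamma uM : R)
    (halpha0 : 0 < alpha) (halpha1 : alpha < 1)
    (hgamma1 : 1 < gamma) (hgamma : gamma < 1 / (1 - alpha))
    (hgammarho : gamma * rho M < 1)
    (huM0 : 0 < uM) (huM : (weighted_cost_sup M gamma <= uM%:E)%E)
    (eps : R) (heps : 0 < eps) :
  let k := truncation_level M alpha gamma uM eps in
  let phi := VI_policy M alpha (VI_horizon alpha gamma uM (eps / 2) k) in
  Phi M phi /\
  (max_saved_cost M Y P alpha - eps%:E <= saved_cost M Y P alpha phi)%E.
Proof.
move=> k; set N := VI_horizon _ _ _ _ k => phi.
have g0 : 0 < gamma by exact: lt_trans hgamma1.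
have rho0 : 0 < rho M by rewrite divr_gt0 ?lambda_gt0 ?mu_gt0.
have rho1 : rho M < 1 by rewrite ltr_pdivrMr ?mu_gt0 // mul1r lambda_lt_mu.
have r0 : 0 < gamma * rho M by rewrite mulr_gt0.
have b0 : 0 < 1 - alpha by rewrite subr_gt0.
have kappa0 : 0 < (1 - alpha) * gamma by rewrite mulr_gt0.
have kappa1 : (1 - alpha) * gamma < 1 by rewrite mulrC -ltr_pdivlMr.
have hu psi x : Phi M psi -> step_cost M psi x <= uM * gamma ^+ x.1.
  exact: weighted_cost_sup_le.
set kappa := (1 - alpha) * gamma in kappa0 kappa1.
set r := gamma * rho M in hgammarho r0.
set C := uM / (1 - kappa).
have C0 : 0 < C by rewrite divr_gt0 ?subr_gt0.
(* Since [pi_mu M i * gamma ^+ i] is [(1 - rho M) * r ^+ i], the left side is the sum of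
   [C * gamma ^+ i] against [pi_mu] over all [i >= k]. *)
have hk : r ^+ k * (C * ((1 - rho M) / (1 - r))) <= eps / 2.
  have x0 : 0 < eps * (1 - r) * (1 - kappa) / (2 * uM * (1 - rho M)).
    by rewrite divr_gt0 ?mulr_gt0 ?subr_gt0.
  have := @expn_ceil_log_base _ r _ 0 r0 hgammarho x0; rewrite -/k => hk.
  rewrite -ler_pdivlMr ?mulr_gt0 ?divr_gt0 ?invr_gt0 ?subr_gt0 //.
  apply: le_trans hk _; rewrite le_eqVlt; apply/orP; left; apply/eqP.
  by rewrite /C; field; rewrite !gt_eqF ?subr_gt0.
have hN : kappa ^+ N * C * gamma ^+ k <= eps / 2.
  have x0 : 0 < eps / 2 * (1 - kappa) / (2 * uM * gamma ^+ k).
    by rewrite divr_gt0 ?mulr_gt0 ?subr_gt0 ?divr_gt0 ?exprn_gt0.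
  have := @expn_ceil_log_base _ kappa _ 1 kappa0 kappa1 x0; rewrite -/N => hN.
  have Cg0 : 0 < C * gamma ^+ k := mulr_gt0 C0 (exprn_gt0 k g0).
  rewrite -mulrA -ler_pdivlMr //; apply: le_trans hN _.
  (* The 2 in the denominator of the horizon formula is a factor to spare: this bounds the head
     error by [eps / 4]. *)
  have -> : eps / 2 * (1 - kappa) / (2 * uM * gamma ^+ k) =
      eps / 2 / (C * gamma ^+ k) / 2.
    have : gamma ^+ k != 0 by rewrite gt_eqF ?exprn_gt0.
    by move: (gamma ^+ k) => G G0; rewrite /C; field; rewrite G0 !gt_eqF ?subr_gt0.
  rewrite ler_pdivrMr // ler_peMr ?ler1n //.
  by rewrite ltW // !divr_gt0.
(* The default 1 makes the horizon a successor, so the predecessor in [VI_policy] is a genuine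
   stage. *)
have [n Nn] : exists n, N = n.+1.
  case E : N => [|n]; last by exists n.
  move: E; rewrite /N /VI_horizon => /eqP; rewrite absz_eq0 => /eqP E.
  by have : (1 : int) <= 0 by rewrite -E le_max lexx.
have phiE : phi = greedy M alpha (VI M alpha n) by rewrite /phi Nn VI_policyE.
have hphi : Phi M phi by rewrite phiE; exact: greedy_Phi.
split=> //.
clearbody phi N k.
(* Values of admissible policies are finite by [VC] below, so the saved costs can be handled as real
   series. *)
pose v psi x := fine (Vdisc M Y P alpha psi x).
have V0 psi x : Phi M psi -> (0 <= Vdisc M Y P alpha psi x)%E.
  by move=> hpsi; exact: (horizon_le_Vdisc hP halpha1 hpsi 0 x).
have VC psi x : Phi M psi ->
    (Vdisc M Y P alpha psi x <= (C * gamma ^+ x.1)%:E)%E.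
  move=> hpsi; apply: Vdisc_le => // m.
  exact: (horizon_le_weight halpha1 hgamma1 kappa1 huM0 hu m x hpsi).
have vE psi x : Phi M psi -> Vdisc M Y P alpha psi x = (v psi x)%:E.
  move=> hpsi; rewrite /v fineK // ge0_fin_numE ?V0 //.
  exact: le_lt_trans (VC _ _ hpsi) (ltry _).
have v0 psi x : Phi M psi -> 0 <= v psi x <= C * gamma ^+ x.1.
  by move=> hpsi; rewrite -!lee_fin -vE // V0 ?VC.
pose a psi i := pi_mu M i * (v psi (i, false) - v psi (i, true)).
have aE psi : Phi M psi ->
    saved_cost M Y P alpha psi = (\sum_(0 <= i <oo) (a psi i)%:E)%E.
  by move=> hpsi; apply: eq_eseriesr => i _; rewrite !vE // -EFinB -EFinM.
have acvg psi : Phi M psi -> cvgn (series (a psi)).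
  move=> hpsi; apply: (@cvg_series_geometric_bound _ _ ((1 - rho M) * C) r).
  - exact: ltW.
  - by [].
  move=> i; rewrite /a /pi_mu normrM ger0_norm; last first.
    by rewrite mulr_ge0 ?exprn_ge0 ?subr_ge0 // ltW.
  have -> : (1 - rho M) * C * r ^+ i = (1 - rho M) * rho M ^+ i * (C * gamma ^+ i).
    by rewrite /r exprMn; ring.
  rewrite ler_wpM2l //; first by rewrite mulr_ge0 ?exprn_ge0 ?subr_ge0 // ltW.
  (* Both values lie between 0 and [C * gamma ^+ i], hence so does the absolute value of their
     difference. *)
  have := v0 psi (i, true) hpsi; have := v0 psi (i, false) hpsi.
  by rewrite /= ler_norml; lra.
rewrite leeBlDr //; apply: ge_ereal_sup => _ [psi hpsi <-].
rewrite !aE //; apply: eseries_le; [exact: acvg|exact: acvg|] => n'.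
have vfalse i : v psi (i, false) = v phi (i, false).
  rewrite /v !VdiscE //; congr fine; apply: eq_eseriesr => j _.
  by rewrite (fixed_iter_unique _ _ hpsi hphi).
have vhead i : v phi (i, true) - v psi (i, true) <= kappa ^+ N * C * gamma ^+ i.
  have h1 : v phi (i, true) <= VI M alpha N (i, true) + kappa ^+ N * C * gamma ^+ i.
    rewrite -lee_fin -vE // Vdisc_le // => m; rewrite phiE Nn.
    have := horizon_le_VI halpha1 hgamma1 kappa1 huM0 hu n m (i, true).
    by rewrite /C mulrA.
  have h2 : VI M alpha N (i, true) <= v psi (i, true).
    rewrite -lee_fin -vE //; apply: le_trans (horizon_le_Vdisc hP halpha1 hpsi N _).
    by rewrite lee_fin (VI_le_horizon halpha1 hgamma1).
  by lra.
(* Termwise bound: [eps / 2] times [pi_mu M i] for every [i], plus [C * gamma ^+ i] times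
   [pi_mu M i] once [i >= k]. The factor [1 - r] is introduced to match [geometric_tail_sum]. *)
apply: (@le_trans _ _ (eps / 2 * (\sum_(i < n') (1 - rho M) * rho M ^+ i) +
    C * ((1 - rho M) / (1 - r)) *
    \sum_(i < n') (if (i < k)%N then 0 else (1 - r) * r ^+ i))).
  rewrite !mulr_sumr -big_split; apply: ler_sum => i _ /=.
  rewrite /a -mulrBr vfalse.
  rewrite (_ : _ - _ = v phi (i : nat, true) - v psi (i : nat, true)); last by ring.
  have p0 : 0 <= pi_mu M i by rewrite mulr_ge0 ?exprn_ge0 ?subr_ge0 // ltW.
  case: ifPn => [ik|ik].
    rewrite mulr0 addr0 mulrC -/(pi_mu M i) ler_wpM2r //.
    apply: le_trans (vhead i) (le_trans _ hN).
    rewrite ler_wpM2l ?ler_weXn2l ?(ltW hgamma1) ?(ltnW ik) //.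
    by rewrite mulr_ge0 ?exprn_ge0 // ltW.
  apply: (@le_trans _ _ (pi_mu M i * (C * gamma ^+ i))).
    rewrite ler_wpM2l //; have := v0 phi (i : nat, true) hphi.
    by have := v0 psi (i : nat, true) hpsi; rewrite /=; lra.
  have -> : C * ((1 - rho M) / (1 - r)) * ((1 - r) * r ^+ i) =
      pi_mu M i * (C * gamma ^+ i).
    by rewrite /pi_mu [r ^+ i]exprMn; field; rewrite gt_eqF ?subr_gt0.
  by rewrite lerDr !mulr_ge0 // ?invr_ge0 ?subr_ge0 ?exprn_ge0 // ltW.
(* The first sum is [1 - rho M ^+ n'], at most 1; the second is at most [r ^+ k], so [hk]
   applies. *)
rewrite geometric_sum.
have h1 := geometric_tail_sum k n' (ltW r0).
have D0 : 0 <= C * ((1 - rho M) / (1 - r)).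
  by rewrite ltW // mulr_gt0 // divr_gt0 ?subr_gt0.
have h2 := ler_wpM2l D0 h1; have h3 := exprn_ge0 n' (ltW rho0).
have h4 := mulr_ge0 (ltW heps) h3.
rewrite mulrC in hk; lra.
Qed.
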